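(* The delooping $B\widehat{H}\mathbb{K}$ of the Krasner hyperfield $\mathbb{K}$ is isomorphic, as a pointed simplicial set, to the delooping $B\,\mathrm{Dynk}$ of the Dynkin $\mathbb{F}_1$-module.
   Context: Let $\mathcal{F}in_*$ be the category with objects $\underline{n}_+=\{0,1,\ldots,n\}$, $n\ge 0$, pointed at $0$, and basepoint-preserving functions. An $\mathbb{F}_1$-module is a functor $X\colon\mathcal{F}in_*\to\mathcal{S}et_*$ to pointed sets with $X(\underline{0}_+)$ a one-element set. The delooping $BX\colon\Delta^{op}\to\mathcal{S}et_*$ of an $\mathbb{F}_1$-module $X$ is the composite of $X$ with the functor $\Delta^{op}\to\mathcal{F}in_*$ given by the simplicial circle $\Delta^1/\partial\Delta^1$: it sends $[n]$ to $\underline{n}_+$ and a non-decreasing map $\alpha\colon[m]\to[n]$ to the pointed function $\underline{n}_+\to\underline{m}_+$ sending $i\geq 1$ to $j$ if $\alpha(j-1)<i\le\alpha(j)$ and to $0$ if there is no such $j\in\{1,\ldots,m\}$. Thus $(BX)_n=X(\underline{n}_+)$. The Dynkin $\mathbb{F}_1$-module: $\mathrm{Dynk}(\underline{n}_+)$ is the set of Dynkin systems on $\underline{n}_+$, i.e. families $X$ of subsets of $\underline{n}_+$ containing $\varnothing$ and closed under complements and under unions of disjoint pairs (since the set is finite, closure under countable disjoint unions is automatic), pointed at the full power set. For a pointed function $\phi\colon\underline{n}_+\to\underline{m}_+$, $\mathrm{Dynk}(\phi)(X)=\{A\subseteq\underline{m}_+:\phi^{-1}(A)\in X\}$. A plasma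 is a set $X$ with a hyperoperation $\star\colon X\times X\to\mathcal{P}(X)$ (empty values allowed) and an element $0\in X$ (the weak identity) such that $x\star y=y\star x$ and $x\in x\star 0$ for all $x,y$. A morphism $(X,\star,0)\to(Y,\boxplus,e)$ is a function $f$ with $f(0)=e$ and $f(x\star x')\subseteq f(x)\boxplus f(x')$. $\mathrm{Plas}(X,Y)$ is the set of plasma morphisms, pointed by the constant morphism at the weak identity. The Krasner hyperfield, regarded as a plasma, is $\mathbb{K}=\{0,1\}$ with weak identity $0$ and $0+0=\{0\}$, $0+1=1+0=\{1\}$, $1+1=\{0,1\}$. The power set plasma $\mathcal{P}(n)$ is the power set of $\{1,\ldots,n\}$ with weak identity $\varnothing$ and $a\star b=\{a\cup b\}$ if $a\cap b=\varnothing$, while $a\star b$ is the empty family otherwise. A pointed function $\phi\colon\underline{n}_+\to\underline{m}_+$ induces the plasma morphism $\phi^{-1}\colon\mathcal{P}(m)\to\mathcal{P}(n)$. The $\mathbb{F}_1$-module $\widehat{H}M$ of a plasma $M$ is $\underline{n}_+\mapsto\mathrm{Plas}(\mathcal{P}(n),M)$, with $\phi$ acting by precomposition with $\phi^{-1}$. *)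

(* Defs.v *)
From mathcomp Require Import all_boot.
From mathcomp Require Import boolp classical_sets.

Set Implicit Arguments.
Unset Strict Implicit.
Unset Printing Implicit Defensive.

Record category := Category {
  obj :> Type;
  hom : obj -> obj -> Type;
  cid : forall a, hom a a;
  ccomp : forall a b c, hom b c -> hom a b -> hom a c;
  ccomp1f : forall a b (f : hom a b), ccomp (cid b) f = f;
  ccompf1 : forall a b (f : hom a b), ccomp f (cid a) = f;
  ccompA : forall a b c d (h : hom c d) (g : hom b c) (f : hom a b),
    ccomp h (ccomp g f) = ccomp (ccomp h g) f }.

Record functor (C D : category) := Functor {
  fobj :> C -> D;
  fmap : forall a b, hom a b -> hom (fobj a) (fobj b);
  fmap_id : forall a, fmap (cid a) = cid (fobj a);
  fmap_comp : forall a b c (g : hom b c) (f : hom a b),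
    fmap (ccomp g f) = ccomp (fmap g) (fmap f) }.

Record nat_trans (C D : category) (F G : functor C D) := NatTrans {
  ncomp :> forall c, hom (F c) (G c);
  ncomp_natural : forall a b (f : hom a b),
    ccomp (ncomp b) (fmap F f) = ccomp (fmap G f) (ncomp a) }.

Definition functors_isomorphic (C D : category) (F G : functor C D) : Prop :=
  exists (s : nat_trans F G) (t : nat_trans G F),
    (forall c, ccomp (t c) (s c) = cid (F c)) /\
    (forall c, ccomp (s c) (t c) = cid (G c)).

Definition op_category (C : category) : category :=
  @Category C (fun a b => @hom C b a) (@cid C) (fun a b c g f => ccomp f g)
    (fun a b f => ccompf1 f) (fun a b f => ccomp1f f)
    (fun a b c d h g f => esym (ccompA f g h)).

Section FunctorComp.
Variables (C D E : category) (G : functor D E) (F : functor C D).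

Lemma functor_comp_id a : fmap G (fmap F (cid a)) = cid (G (F a)).
Proof. by rewrite !fmap_id. Qed.

Lemma functor_comp_comp a b c (g : hom b c) (f : hom a b) :
  fmap G (fmap F (ccomp g f)) = ccomp (fmap G (fmap F g)) (fmap G (fmap F f)).
Proof. by rewrite !fmap_comp. Qed.

Definition functor_comp : functor C E :=
  @Functor C E (fun a => G (F a)) (fun a b f => fmap G (fmap F f))
    functor_comp_id functor_comp_comp.
End FunctorComp.

(* The library's pointedType also carries an equality test and a choice
   operator, which are not part of a pointed set. *)
Record pointed_set := PointedSet { psort :> Type; ppt : psort }.

Record pointed_map (X Y : pointed_set) := PointedMap {
  pfun :> X -> Y;
  pfun_pt : pfun (ppt X) = ppt Y }.

Lemma pointed_map_eq (X Y : pointed_set) (f g : pointed_map X Y) :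
  (forall x, f x = g x) -> f = g.
Proof.
case: f g => f pf [g pg] /= /funext fg.
by case: _ / fg pg => pg; rewrite (Prop_irrelevance pf pg).
Qed.

Definition pointed_id (X : pointed_set) : pointed_map X X :=
  @PointedMap X X id erefl.

Lemma pointed_comp_pt (X Y Z : pointed_set) (g : pointed_map Y Z)
  (f : pointed_map X Y) : g (f (ppt X)) = ppt Z.
Proof. by rewrite !pfun_pt. Qed.

Definition pointed_comp (X Y Z : pointed_set) (g : pointed_map Y Z)
    (f : pointed_map X Y) : pointed_map X Z :=
  @PointedMap X Z (fun x => g (f x)) (pointed_comp_pt g f).

Lemma pointed_comp1f X Y (f : pointed_map X Y) :
  pointed_comp (pointed_id Y) f = f.
Proof. exact: pointed_map_eq. Qed.

Lemma pointed_compf1 X Y (f : pointed_map X Y) :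
  pointed_comp f (pointed_id X) = f.
Proof. exact: pointed_map_eq. Qed.

Lemma pointed_compA X Y Z W (h : pointed_map Z W) (g : pointed_map Y Z)
  (f : pointed_map X Y) :
  pointed_comp h (pointed_comp g f) = pointed_comp (pointed_comp h g) f.
Proof. exact: pointed_map_eq. Qed.

Definition Set_star : category :=
  Category pointed_comp1f pointed_compf1 pointed_compA.

Definition nplus (n : nat) : pointed_set := @PointedSet 'I_n.+1 ord0.

(* The object n stands for n_+ = {0, ..., n}. *)
Definition Fin_star : category :=
  @Category nat (fun n m => pointed_map (nplus n) (nplus m))
    (fun n => pointed_id (nplus n))
    (fun n m p g f => pointed_comp g f)
    (fun n m f => pointed_comp1f f) (fun n m f => pointed_compf1 f)
    (fun n m p q h g f => pointed_compA h g f).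

(* The object n stands for [n] = {0 < ... < n}. *)
Record delta_hom (m n : nat) := DeltaHom {
  dfun :> 'I_m.+1 -> 'I_n.+1;
  dfun_mono : forall i j : 'I_m.+1, i <= j -> dfun i <= dfun j }.

Lemma delta_hom_eq m n (f g : delta_hom m n) : (forall x, f x = g x) -> f = g.
Proof.
case: f g => f pf [g pg] /= /funext fg.
by case: _ / fg pg => pg; rewrite (Prop_irrelevance pf pg).
Qed.

Definition delta_id n : delta_hom n n := @DeltaHom n n id (fun i j h => h).

Definition delta_comp m n p (g : delta_hom n p) (f : delta_hom m n) :
    delta_hom m p :=
  @DeltaHom m p (fun i => g (f i))
    (fun i j h => dfun_mono g (dfun_mono f h)).

Lemma delta_comp1f m n (f : delta_hom m n) : delta_comp (delta_id n) f = f.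
Proof. exact: delta_hom_eq. Qed.

Lemma delta_compf1 m n (f : delta_hom m n) : delta_comp f (delta_id m) = f.
Proof. exact: delta_hom_eq. Qed.

Lemma delta_compA m n p q (h : delta_hom p q) (g : delta_hom n p)
  (f : delta_hom m n) :
  delta_comp h (delta_comp g f) = delta_comp (delta_comp h g) f.
Proof. exact: delta_hom_eq. Qed.

Definition Delta : category := Category delta_comp1f delta_compf1 delta_compA.

Definition pointed_simplicial_set := functor (op_category Delta) Set_star.

(* i goes to the unique j >= 1 with a (j - 1) < i <= a j, and to 0 if there is
   none; for i = 0 there never is one. *)
Definition circle_fun m n (a : delta_hom m n) (i : 'I_n.+1) : 'I_m.+1 :=
  odflt ord0
    [pick j : 'I_m.+1 | (0 < j) && (a (inord j.-1) < i <= a j)].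

Variant circle_spec m n (a : delta_hom m n) (i : 'I_n.+1) : 'I_m.+1 -> Prop :=
| CircleJump (j : 'I_m.+1) of 0 < j & (forall p, (i <= a p) = (j <= p)) :
    circle_spec a i j
| CircleConst b of (forall p, (i <= a p) = b) : circle_spec a i ord0.

Lemma circle_funP m n (a : delta_hom m n) i : circle_spec a i (circle_fun a i).
Proof.
rewrite /circle_fun; case: pickP => [j /and3P[j0 ai ia]|noj] /=.
  apply: CircleJump => // p; case: (leqP j p) => jp.
    by rewrite (leq_trans ia) // dfun_mono.
  apply/negbTE; rewrite -ltnNge; apply: leq_ltn_trans ai.
  apply: dfun_mono; rewrite inordK; first by rewrite -ltnS prednK.
  by rewrite prednK // ltnW.
apply: (CircleConst (b := i <= a ord0)) => p.
suff H k : k < m.+1 -> (i <= a (inord k)) = (i <= a ord0).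
  by rewrite -[p]inord_val H.
elim: k => [|k IH] km; first by congr (_ <= a _); apply/val_inj; rewrite /= inordK.
have:= noj (inord k.+1); rewrite inordK //= => /negbT.
rewrite negb_and -leqNgt -ltnNge -(IH (ltnW km)) => /orP[h|h].
  by rewrite h (leq_trans h) // dfun_mono // !inordK // ltnW.
rewrite leqNgt h; apply/esym/negbTE; rewrite -ltnNge; apply: leq_ltn_trans h.
by apply: dfun_mono; rewrite !inordK // ltnW.
Qed.

Lemma circle_spec_uniq m n (a : delta_hom m n) i j j' :
  circle_spec a i j -> circle_spec a i j' -> j = j'.
Proof.
have jump_const (k : 'I_m.+1) b : 0 < k -> (forall p, (i <= a p) = (k <= p)) ->
    (forall p, (i <= a p) = b) -> False.
  by move=> k0 h h'; have:= h ord0; rewrite h' -(h' k) h leqnn leqNgt k0.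
move=> [k k0 h|b h] [k' k0' h'|b' h'] //.
- by apply/val_inj/anti_leq; rewrite -h h' leqnn /= -h' h leqnn.
- by case: (jump_const k b').
- by case: (jump_const k' b).
Qed.

Lemma circle_fun_id n i : circle_fun (delta_id n) i = i.
Proof.
apply: (circle_spec_uniq (circle_funP _ _)).
have [i0|i0] := posnP i; last exact: CircleJump.
have -> : i = ord0 by apply/val_inj.
exact: (CircleConst (b := true)).
Qed.

Lemma circle_fun_comp m n p (b : delta_hom n p) (a : delta_hom m n) i :
  circle_fun (delta_comp b a) i = circle_fun a (circle_fun b i).
Proof.
apply: (circle_spec_uniq (circle_funP _ _)).
case: (circle_funP b i) => [j j0 hj|c hc].
  case: (circle_funP a j) => [k k0 hk|c hc].
    by apply: CircleJump => // q; rewrite hj hk.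
  by apply: (CircleConst (b := c)) => q; rewrite hj hc.
case: (circle_funP a ord0) => [k k0 hk|d hd].
  by have:= hk ord0; rewrite leq0n leqNgt k0.
by apply: (CircleConst (b := c)) => q; rewrite hc.
Qed.

Lemma circle_fun0 m n (a : delta_hom m n) :
  circle_fun a (ppt (nplus n)) = ppt (nplus m).
Proof. by rewrite /circle_fun; case: pickP => // j; rewrite ltn0 andbF. Qed.

Definition circle_map m n (a : delta_hom m n) :
    pointed_map (nplus n) (nplus m) :=
  @PointedMap (nplus n) (nplus m) (circle_fun a) (circle_fun0 a).

Lemma circle_map_id n : circle_map (delta_id n) = pointed_id (nplus n).
Proof. exact/pointed_map_eq/circle_fun_id. Qed.

Lemma circle_map_comp m n p (b : delta_hom n p) (a : delta_hom m n) :
  circle_map (delta_comp b a) = pointed_comp (circle_map a) (circle_map b).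
Proof. exact/pointed_map_eq/circle_fun_comp. Qed.

Definition simplicial_circle : functor (op_category Delta) Fin_star :=
  @Functor (op_category Delta) Fin_star (fun n : nat => n)
    (fun n m (a : delta_hom m n) => circle_map a) circle_map_id
    (fun p n m (a : delta_hom m n) (b : delta_hom n p) => circle_map_comp b a).

Record F1_module := F1Module {
  F1_functor :> functor Fin_star Set_star;
  F1_reduced : forall x y : F1_functor 0, x = y }.

Definition delooping (X : F1_module) : pointed_simplicial_set :=
  functor_comp X simplicial_circle.

Section DynkinSystem.
Variable T : finType.

Definition is_dynkin (X : {set {set T}}) : bool :=
  [&& finset.set0 \in X, [forall A in X, ~: A \in X] &
      [forall A in X, forall B in X, [disjoint A & B] ==> (A :|: B \in X)]].

Lemma is_dynkinP (X : {set {set T}}) :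
  reflect [/\ finset.set0 \in X, forall A, A \in X -> ~: A \in X &
    forall A B, A \in X -> B \in X -> [disjoint A & B] -> A :|: B \in X]
    (is_dynkin X).
Proof.
apply: (iffP and3P) => [] [X0 XC XU]; split => //.
- by move=> A AX; exact: (forall_inP XC).
- move=> A B AX BX dAB.
  by have /forall_inP/(_ B BX)/implyP/(_ dAB) := forall_inP XU A AX.
- by apply/forall_inP.
- apply/forall_inP => A AX; apply/forall_inP => B BX.
  by apply/implyP; exact: XU.
Qed.

Definition dynkin_system := {X : {set {set T}} | is_dynkin X}.

Lemma is_dynkinT : is_dynkin [set: {set T}].
Proof. by apply/is_dynkinP; split=> *; rewrite inE. Qed.
End DynkinSystem.

Definition Dynk_obj (n : nat) : pointed_set :=
  @PointedSet (dynkin_system 'I_n.+1)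
    (exist _ [set: {set 'I_n.+1}] (is_dynkinT 'I_n.+1)).

Section DynkMap.
Variables (n m : nat) (phi : pointed_map (nplus n) (nplus m)).

Definition dynkin_push (X : {set {set 'I_n.+1}}) : {set {set 'I_m.+1}} :=
  [set A : {set 'I_m.+1} | phi @^-1: A \in X].

Lemma dynkin_push_is_dynkin (X : {set {set 'I_n.+1}}) : is_dynkin X -> is_dynkin (dynkin_push X).
Proof.
move=> /is_dynkinP[X0 XC XU]; apply/is_dynkinP; split.
- by rewrite inE preimset0.
- by move=> A; rewrite !inE preimsetC; exact: XC.
- move=> A B; rewrite !inE preimsetU => AX BX dAB; apply: XU => //.
  by rewrite -setI_eq0 -preimsetI (disjoint_setI0 dAB) preimset0.
Qed.

Definition Dynk_fun (X : Dynk_obj n) : Dynk_obj m :=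
  exist _ (dynkin_push (val X)) (dynkin_push_is_dynkin (valP X)).

Lemma Dynk_fun_pt : Dynk_fun (ppt (Dynk_obj n)) = ppt (Dynk_obj m).
Proof. by apply/val_inj/setP => A; rewrite !inE. Qed.

Definition Dynk_map : pointed_map (Dynk_obj n) (Dynk_obj m) :=
  @PointedMap (Dynk_obj n) (Dynk_obj m) Dynk_fun Dynk_fun_pt.
End DynkMap.

Lemma Dynk_map_id n : Dynk_map (pointed_id (nplus n)) = pointed_id (Dynk_obj n).
Proof.
apply: pointed_map_eq => X; apply/val_inj/setP => A; rewrite inE /=.
by have -> : id @^-1: A = A by apply/setP => i; rewrite inE.
Qed.

Lemma Dynk_map_comp n m p (g : pointed_map (nplus m) (nplus p))
    (f : pointed_map (nplus n) (nplus m)) :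
  Dynk_map (pointed_comp g f) = pointed_comp (Dynk_map g) (Dynk_map f).
Proof.
apply: pointed_map_eq => X; apply/val_inj/setP => A; rewrite !inE /=.
by have -> : (fun x => g (f x)) @^-1: A = f @^-1: (g @^-1: A)
  by apply/setP => i; rewrite !inE.
Qed.

Definition Dynk_functor : functor Fin_star Set_star :=
  @Functor Fin_star Set_star Dynk_obj Dynk_map Dynk_map_id Dynk_map_comp.

Lemma Dynk_reduced (X Y : Dynk_functor 0) : X = Y.
Proof.
suff full (Z : dynkin_system 'I_1) (A : {set 'I_1}) : A \in val Z.
  by apply/val_inj/setP => A; rewrite !full.
have /is_dynkinP[Z0 ZC _] := valP Z.
have [A0|A0] := boolP (ord0 \in A); last first.
  suff -> : A = finset.set0 by [].
  by apply/setP => i; rewrite inE (ord1 i); exact: negbTE.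
suff -> : A = ~: finset.set0 by exact: ZC.
by apply/setP => i; rewrite !inE (ord1 i).
Qed.

Definition Dynk : F1_module := F1Module Dynk_reduced.

Local Open Scope classical_set_scope.

Record plasma := Plasma {
  pl_sort :> Type;
  hop : pl_sort -> pl_sort -> set pl_sort;
  pl0 : pl_sort;
  hopC : forall x y, hop x y = hop y x;
  hop_weak_id : forall x, hop x pl0 x }.

Record plasma_hom (X Y : plasma) := PlasmaHom {
  plfun :> X -> Y;
  plfun0 : plfun (pl0 X) = pl0 Y;
  plfun_hop : forall x x' : X,
    plfun @` (hop x x') `<=` hop (plfun x) (plfun x') }.

Lemma plasma_hom_eq (X Y : plasma) (f g : plasma_hom X Y) :
  (forall x, f x = g x) -> f = g.
Proof.
case: f g => f f0 pf [g g0 pg] /= /funext fg.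
case: _ / fg g0 pg => g0 pg.
by rewrite (Prop_irrelevance f0 g0) (Prop_irrelevance pf pg).
Qed.

Lemma plasma_comp0 (X Y Z : plasma) (g : plasma_hom Y Z) (f : plasma_hom X Y) :
  g (f (pl0 X)) = pl0 Z.
Proof. by rewrite !plfun0. Qed.

Lemma plasma_comp_hop (X Y Z : plasma) (g : plasma_hom Y Z)
    (f : plasma_hom X Y) (x x' : X) :
  (fun u => g (f u)) @` (hop x x') `<=` hop (g (f x)) (g (f x')).
Proof.
move=> _ [u ux <-]; apply: plfun_hop; exists (f u) => //.
by apply: plfun_hop; exists u.
Qed.

Definition plasma_comp (X Y Z : plasma) (g : plasma_hom Y Z)
    (f : plasma_hom X Y) : plasma_hom X Z :=
  @PlasmaHom X Z (fun x => g (f x)) (plasma_comp0 g f)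
    (@plasma_comp_hop X Y Z g f).

Lemma plasma_const_hop (X Y : plasma) (x x' : X) :
  (fun=> pl0 Y) @` (hop x x') `<=` hop (pl0 Y) (pl0 Y).
Proof. by move=> _ [u _ <-]; exact: hop_weak_id. Qed.

Definition plasma_const (X Y : plasma) : plasma_hom X Y :=
  @PlasmaHom X Y (fun=> pl0 Y) erefl (@plasma_const_hop X Y).

Definition Plas (X Y : plasma) : pointed_set :=
  @PointedSet (plasma_hom X Y) (plasma_const X Y).

(* false is 0 and true is 1. *)
Definition krasner_add (x y : bool) : set bool :=
  match x, y with
  | false, false => [set false]
  | true, true => [set false; true]
  | _, _ => [set true]
  end.

Lemma krasner_addC x y : krasner_add x y = krasner_add y x.
Proof. by case: x; case: y. Qed.

Lemma krasner_add0 x : krasner_add x false x.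
Proof. by case: x. Qed.

Definition krasner : plasma := Plasma krasner_addC krasner_add0.

(* Subsets of {1, ..., n}, as the subsets of n_+ that avoid the basepoint. *)
Definition powset (n : nat) := {a : {set 'I_n.+1} | ord0 \notin a}.

Section PowersetPlasma.
Variable n : nat.

Lemma powset0_proof : ord0 \notin (finset.set0 : {set 'I_n.+1}).
Proof. by rewrite inE. Qed.

Definition powset0 : powset n := exist _ finset.set0 powset0_proof.

Lemma powsetU_proof (a b : powset n) : ord0 \notin val a :|: val b.
Proof. by rewrite inE negb_or (valP a) (valP b). Qed.

Definition powsetU (a b : powset n) : powset n :=
  exist _ (val a :|: val b) (powsetU_proof a b).

Definition powset_hop (a b : powset n) : set (powset n) :=
  if [disjoint val a & val b] then [set powsetU a b] else set0.

Lemma powset_hopC a b : powset_hop a b = powset_hop b a.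
Proof.
rewrite /powset_hop disjoint_sym; case: ifP => // _; congr [set _].
by apply/val_inj; rewrite /= finset.setUC.
Qed.

Lemma powset_hop0 a : powset_hop a powset0 a.
Proof.
rewrite /powset_hop -setI_eq0 finset.setI0 eqxx.
by apply/val_inj; rewrite /= finset.setU0.
Qed.

Definition powerset_plasma : plasma := Plasma powset_hopC powset_hop0.
End PowersetPlasma.

Section PowersetPreimage.
Variables (n m : nat) (phi : pointed_map (nplus n) (nplus m)).

Lemma powset_preim_proof (a : powset m) :
  ord0 \notin phi @^-1: (val a : {set 'I_m.+1}).
Proof. by rewrite inE (pfun_pt phi) (valP a). Qed.

Definition powset_preim (a : powerset_plasma m) : powerset_plasma n :=
  exist _ (phi @^-1: (val a : {set 'I_m.+1})) (powset_preim_proof a).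

Lemma powset_preim0 :
  powset_preim (pl0 (powerset_plasma m)) = pl0 (powerset_plasma n).
Proof. by apply/val_inj; rewrite /= preimset0. Qed.

Lemma powset_preim_hop (a b : powerset_plasma m) :
  powset_preim @` (hop a b) `<=` hop (powset_preim a) (powset_preim b).
Proof.
move=> _ [c + <-]; rewrite /hop /= /powset_hop.
case: ifP => // dab -> /=.
rewrite -setI_eq0 -preimsetI (disjoint_setI0 dab) preimset0 eqxx.
by apply/val_inj; rewrite /= preimsetU.
Qed.

Definition powerset_preimage :
    plasma_hom (powerset_plasma m) (powerset_plasma n) :=
  @PlasmaHom (powerset_plasma m) (powerset_plasma n) powset_preim
    powset_preim0 powset_preim_hop.
End PowersetPreimage.

Section HhatModule.
Variable M : plasma.

Definition Hhat_obj (n : nat) : pointed_set := Plas (powerset_plasma n) M.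

Lemma Hhat_map_pt n m (phi : pointed_map (nplus n) (nplus m)) :
  plasma_comp (ppt (Hhat_obj n)) (powerset_preimage phi) = ppt (Hhat_obj m).
Proof. exact: plasma_hom_eq. Qed.

Definition Hhat_map n m (phi : pointed_map (nplus n) (nplus m)) :
    pointed_map (Hhat_obj n) (Hhat_obj m) :=
  @PointedMap (Hhat_obj n) (Hhat_obj m)
    (fun f => plasma_comp f (powerset_preimage phi)) (Hhat_map_pt phi).

Lemma Hhat_map_id n : Hhat_map (pointed_id (nplus n)) = pointed_id (Hhat_obj n).
Proof.
apply: pointed_map_eq => f; apply: plasma_hom_eq => a /=; congr (f _).
by apply/val_inj/setP => i; rewrite inE.
Qed.

Lemma Hhat_map_comp n m p (g : pointed_map (nplus m) (nplus p))
    (f : pointed_map (nplus n) (nplus m)) :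
  Hhat_map (pointed_comp g f) = pointed_comp (Hhat_map g) (Hhat_map f).
Proof.
apply: pointed_map_eq => h; apply: plasma_hom_eq => a /=; congr (h _).
by apply/val_inj/setP => i; rewrite !inE.
Qed.

Definition Hhat_functor : functor Fin_star Set_star :=
  @Functor Fin_star Set_star Hhat_obj Hhat_map Hhat_map_id Hhat_map_comp.

Lemma Hhat_reduced (f g : Hhat_functor 0) : f = g.
Proof.
apply: plasma_hom_eq => a.
suff -> : a = pl0 (powerset_plasma 0) by rewrite !plfun0.
apply/val_inj/setP => i; rewrite inE (ord1 i).
exact/negbTE/(valP a).
Qed.

Definition Hhat : F1_module := F1Module Hhat_reduced.
End HhatModule.

(* Main.v *)
From mathcomp Require Import all_boot.
From mathcomp Require Import boolp classical_sets.
Require Import Defs.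

(** The two F_1-modules are already isomorphic as functors on finite pointed
    sets ([Hhat_krasner_Dynk_iso]); precomposing with the simplicial circle
    preserves this isomorphism.

    A morphism [f] from the power set plasma to the Krasner hyperfield is
    determined by its zero set [Z], a family of subsets of {1, ..., n}.  Since
    [0 + 0 = {0}], [0 + 1 = {1}] and [1 + 1] is everything, [f] is a morphism
    exactly when [Z] contains the empty set and, for disjoint [a] and [b] with
    [a] in [Z], [b] is in [Z] if and only if [a :|: b] is.  So [Z] is closed
    under disjoint unions and under differences [c :\: a] with
    [a] included in [c].

    Such a [Z] is the same thing as a Dynkin system on {0, ..., n}.  The members
    of a Dynkin system that avoid the basepoint have the two closure properties,
    because [c :\: a] is the complement of the disjoint union of [~: c] and [a];
    they determine the system, because of any two complementary sets exactly one
    avoids the basepoint.  Conversely, completing [Z] by the complements of its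
    members ([krasner_dynkin]) gives a Dynkin system: two disjoint sets cannot
    both contain the basepoint, and [~: (a :|: b) = ~: b :\: a].  Choosing the
    member of {A, ~: A} that avoids the basepoint commutes with preimages under
    pointed maps ([unbase_preim]), which gives naturality. *)

Set Implicit Arguments.
Unset Strict Implicit.
Unset Printing Implicit Defensive.

Lemma functors_isomorphic_of_inverses (C D : category) (F G : functor C D)
    (s : nat_trans F G) (t : forall c, hom (G c) (F c)) :
  (forall c, ccomp (t c) (s c) = cid (F c)) ->
  (forall c, ccomp (s c) (t c) = cid (G c)) ->
  functors_isomorphic F G.
Proof.
move=> ts st.
have t_natural a b (f : hom a b) :
    ccomp (t b) (fmap G f) = ccomp (fmap F f) (t a).
  rewrite -[LHS]ccompf1 -(st a) ccompA -(ccompA (t b)) -ncomp_natural.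
  by rewrite (ccompA (t b)) ts ccomp1f.
by exists s, (NatTrans t_natural).
Qed.

Lemma functors_isomorphic_comp (C D E : category) (F G : functor D E)
    (K : functor C D) :
  functors_isomorphic F G ->
  functors_isomorphic (functor_comp F K) (functor_comp G K).
Proof.
move=> [s [t [ts st]]].
pose whisker (H L : functor D E) (u : nat_trans H L) :=
  @NatTrans C E (functor_comp H K) (functor_comp L K) (fun c => u (K c))
    (fun a b f => ncomp_natural u (fmap K f)).
exists (whisker _ _ s), (whisker _ _ t).
by split=> c; [exact: ts | exact: st].
Qed.

Section Unbase.
Variable n : nat.

Lemma unbase_proof (A : {set 'I_n.+1}) :
  ord0 \notin (if ord0 \in A then ~: A else A).
Proof. by case: ifPn => //; rewrite inE negbK. Qed.

(** The representative of {A, ~: A} that avoids the basepoint, through which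
    Dynkin systems on {0, ..., n} are compared with families of subsets of
    {1, ..., n}. *)
Definition unbase (A : {set 'I_n.+1}) : powset n :=
  exist _ (if ord0 \in A then ~: A else A) (unbase_proof A).

Lemma unbase_id (A : {set 'I_n.+1}) : ord0 \notin A -> val (unbase A) = A.
Proof. by rewrite /= => /negbTE->. Qed.

Lemma val_unbaseK (a : powset n) : unbase (val a) = a.
Proof. exact/val_inj/unbase_id/(valP a). Qed.

Lemma unbaseC (A : {set 'I_n.+1}) : unbase (~: A) = unbase A.
Proof. by apply/val_inj; rewrite /= inE finset.setCK if_neg. Qed.

(** Closure under complements makes membership in a Dynkin system depend only
    on the member of {A, ~: A} that avoids the basepoint. *)
Lemma dynkin_unbase (X : dynkin_system 'I_n.+1) (A : {set 'I_n.+1}) :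
  (val (unbase A) \in val X) = (A \in val X).
Proof.
have /is_dynkinP[_ XC _] := valP X.
rewrite /=; case: ifP => // _; apply/idP/idP; last exact: XC.
by move=> /XC; rewrite finset.setCK.
Qed.
End Unbase.

Lemma unbase_preim n m (phi : pointed_map (nplus n) (nplus m))
    (A : {set 'I_m.+1}) :
  unbase (phi @^-1: A) = powset_preim phi (unbase A).
Proof.
apply/val_inj; rewrite /= inE (pfun_pt phi).
by case: ifP => // _; rewrite preimsetC.
Qed.

Section KrasnerZeros.
Variables (n : nat) (f : plasma_hom (powerset_plasma n) krasner).

Lemma krasner_hopU (a b : powset n) :
  [disjoint val a & val b] -> krasner_add (f a) (f b) (f (powsetU a b)).
Proof.
move=> dab; apply: (plfun_hop (p := f)).
by exists (powsetU a b) => //; rewrite /hop /= /powset_hop dab.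
Qed.

(** Up to symmetry this is all that the morphism condition says, because
    [1 + 1] contains both values. *)
Lemma krasner_zeroU (a b : powset n) :
  [disjoint val a & val b] -> f a = false -> f (powsetU a b) = f b.
Proof. by move=> /krasner_hopU + fa; rewrite fa; case: (f b). Qed.

(** Extends the previous lemma to sets [B] that contain the basepoint.  Then
    [~: B] is the disjoint union of [A] and [~: (A :|: B)], so the same lemma
    applies with [~: (A :|: B)] in the place of [B]. *)
Lemma krasner_unbaseU (A B : {set 'I_n.+1}) :
  [disjoint A & B] -> ord0 \notin A ->
  f (unbase A) = false -> f (unbase (A :|: B)) = f (unbase B).
Proof.
move=> dAB A0 fA; have [B0|B0] := boolP (ord0 \in B).
  have -> : unbase B = powsetU (unbase A) (unbase (A :|: B)).
    apply/val_inj; rewrite /= finset.inE B0 orbT (negbTE A0).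
    apply/setP => i; rewrite !finset.inE.
    by have := disjointFr dAB (x := i); case: (i \in A) => // ->.
  rewrite krasner_zeroU //= (negbTE A0) finset.inE B0 orbT.
  by rewrite -setI_eq0 finset.setCU finset.setIA finset.setICr finset.set0I.
have AB0 : ord0 \notin A :|: B by rewrite finset.inE negb_or A0.
have -> : unbase (A :|: B) = powsetU (unbase A) (unbase B).
  by apply/val_inj; rewrite /= (negbTE A0) (negbTE B0) (negbTE AB0).
by rewrite krasner_zeroU // !unbase_id.
Qed.

(** The zero set of [f] together with the complements of its members. *)
Definition krasner_zeros : {set {set 'I_n.+1}} :=
  [set A : {set 'I_n.+1} | ~~ (f (unbase A) : bool)].

Lemma krasner_zeros_is_dynkin : is_dynkin krasner_zeros.
Proof.
apply/is_dynkinP; split.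
- rewrite finset.inE.
  have -> : unbase finset.set0 = pl0 (powerset_plasma n).
    exact: (val_unbaseK (powset0 n)).
  by rewrite plfun0.
- by move=> A; rewrite !finset.inE unbaseC.
- move=> A B; rewrite !finset.inE => /negbTE fA /negbTE fB dAB.
  (* By disjointness at most one of [A] and [B] contains the basepoint. *)
  have [A0|A0] := boolP (ord0 \in A); last by rewrite krasner_unbaseU ?fB.
  have B0 : ord0 \notin B by rewrite (disjointFr dAB A0).
  by rewrite finset.setUC krasner_unbaseU ?fA // disjoint_sym.
Qed.

Definition krasner_dynkin : Dynk_obj n :=
  exist _ krasner_zeros krasner_zeros_is_dynkin.
End KrasnerZeros.

Section DynkinKrasner.
Variables (n : nat) (X : Dynk_obj n).

Lemma dynkin_krasner0 : (finset.set0 \notin val X) = false.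
Proof. by have /is_dynkinP[-> _ _] := valP X. Qed.

(** Dynkin systems are closed under differences, since
    [B = ~: (A :|: ~: (A :|: B))] for disjoint [A] and [B]. *)
Lemma dynkin_memU (A B : {set 'I_n.+1}) :
  [disjoint A & B] -> A \in val X -> (A :|: B \in val X) = (B \in val X).
Proof.
have /is_dynkinP[_ XC XU] := valP X.
move=> dAB AX; apply/idP/idP => [ABX|BX]; last exact: XU.
have -> : B = ~: (A :|: ~: (A :|: B)).
  apply/setP => i; rewrite !finset.inE.
  have := disjointFr dAB (x := i); case: (i \in A) => //= [->//|_].
  by rewrite negbK.
apply/XC/XU => //; first exact: XC.
by rewrite -setI_eq0 finset.setCU finset.setIA finset.setICr finset.set0I.
Qed.

Lemma dynkin_krasner_hop (a b : powerset_plasma n) :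
  ((fun c : powerset_plasma n => (val c \notin val X) : krasner)
     @` (hop a b) `<=` hop (val a \notin val X : krasner) (val b \notin val X))%classic.
Proof.
move=> _ [c + <-]; rewrite /hop /= /powset_hop; case: ifP => // dab -> /=.
have [aX|aX] := boolP (val a \in val X).
  by rewrite dynkin_memU //; case: (val b \in val X).
have [bX|_] := boolP (val b \in val X).
  by rewrite finset.setUC dynkin_memU // 1?disjoint_sym // aX.
by case: (_ \in _); [left | right].
Qed.

Definition dynkin_krasner : Hhat_obj krasner n :=
  @PlasmaHom (powerset_plasma n) krasner (fun a => val a \notin val X)
    dynkin_krasner0 dynkin_krasner_hop.
End DynkinKrasner.

Lemma krasner_dynkinK n : cancel (@krasner_dynkin n) (@dynkin_krasner n).
Proof.
move=> f; apply: plasma_hom_eq => a.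
by rewrite /= finset.inE negbK val_unbaseK.
Qed.

Lemma dynkin_krasnerK n : cancel (@dynkin_krasner n) (@krasner_dynkin n).
Proof.
move=> X; apply/val_inj/setP => A.
by rewrite finset.inE negbK dynkin_unbase.
Qed.

Lemma krasner_dynkin_pt n :
  krasner_dynkin (ppt (Hhat_obj krasner n)) = ppt (Dynk_obj n).
Proof. by apply/val_inj/setP => A; rewrite !finset.inE. Qed.

Lemma dynkin_krasner_pt n :
  dynkin_krasner (ppt (Dynk_obj n)) = ppt (Hhat_obj krasner n).
Proof. by rewrite -krasner_dynkin_pt krasner_dynkinK. Qed.

Definition krasner_dynkin_map n :
    pointed_map (Hhat_obj krasner n) (Dynk_obj n) :=
  PointedMap (@krasner_dynkin_pt n).

Definition dynkin_krasner_map n :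
    pointed_map (Dynk_obj n) (Hhat_obj krasner n) :=
  PointedMap (@dynkin_krasner_pt n).

Lemma krasner_dynkin_natural n m (phi : pointed_map (nplus n) (nplus m)) :
  pointed_comp (krasner_dynkin_map m) (Hhat_map krasner phi) =
  pointed_comp (Dynk_map phi) (krasner_dynkin_map n).
Proof.
apply: pointed_map_eq => f; apply/val_inj/setP => A.
by rewrite !finset.inE unbase_preim.
Qed.

Definition Hhat_krasner_to_Dynk :
    nat_trans (Hhat_functor krasner) Dynk_functor :=
  @NatTrans Fin_star Set_star (Hhat_functor krasner) Dynk_functor
    krasner_dynkin_map krasner_dynkin_natural.

Lemma Hhat_krasner_Dynk_iso :
  functors_isomorphic (Hhat_functor krasner) Dynk_functor.
Proof.
apply: (functors_isomorphic_of_inverses (s := Hhat_krasner_to_Dynk)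
  (t := dynkin_krasner_map)) => n.
- exact/pointed_map_eq/krasner_dynkinK.
- exact/pointed_map_eq/dynkin_krasnerK.
Qed.

Theorem corollary4p8 :
  functors_isomorphic (delooping (Hhat krasner)) (delooping Dynk).
Proof. exact/functors_isomorphic_comp/Hhat_krasner_Dynk_iso. Qed.
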